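(* Let $\mathcal H$ be a real Hilbert space, let $M\in\mathbb R^{d\times n}$, let $L\in\mathbb R^{n\times n}$ be lower triangular with diagonal entries less than $1$, and let $(\mu_i)_{i=1}^n$, $(l_i)_{i=1}^n$ satisfy $0\le\mu_i<l_i$ for all $i\in[n]$. With $\tilde S$ the matrix-valued function defined in the context, consider the problem $$\begin{aligned}\min_{\phi,\lambda,\psi,\gamma}\quad&\psi\\ \text{subject to}\quad&\tilde S(\phi,\lambda,\psi,\gamma)\succeq0,\\&\phi\ge0,\ \lambda\ge0,\\&\phi,\lambda\in\mathbb R^n,\ \psi,\gamma\in\mathbb R.\end{aligned}\qquad(\mathrm D)$$ (i) If the value of $\gamma$ is provided in the iteration $$\mathbf x^k=J_{\mathbf A}(-\mathbf M^T\mathbf z^k+\mathbf L\mathbf x^k),\qquad\mathbf z^{k+1}=\mathbf z^k+\gamma\mathbf M\mathbf x^k,$$ then fixing this $\gamma$ in $(\mathrm D)$ and optimizing over the remaining variables provides an optimal value which upper bounds the worst-case contraction factor $$\tau=\frac{\|\mathbf z_1^1-\mathbf z_2^1\|^2}{\|\mathbf z_1^0-\mathbf z_2^0\|^2}$$ of the iteration over all initial values $\mathbf z_1^0\ne\mathbf z_2^0$ in $\mathcal H^d$ and all possible $\mu_i$-strongly monotone $l_i$-Lipschitz operators $(A_i)_{i\in[n]}$. When $\dim(\mathcal H)\ge d+n$, this bound is tight, i.e. the optimal value equals the supremum of $\tau$. (ii) If $\gamma$ is optimized over, along with the remaining variables in $(\mathrm D)$, then the resulting optimal $\gamma$ is the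 choice of $\gamma$ which minimizes the upper bound on the worst-case contraction factor in (i).
   Context: Here $[n]=\{1,\dots,n\}$; $e_i\in\mathbb R^n$ is the $i$th standard basis vector; $M_{\cdot i}$ is the $i$th column of $M$ and $L_{i\cdot}$ the $i$th row of $L$. Define symmetric block matrices of size $d+n$ (blocks of sizes $d$ and $n$): $$K_I=\begin{bmatrix}\mathrm{Id}&0\\0&0\end{bmatrix},\qquad K_{\mu_i}=\begin{bmatrix}0&-\tfrac12M_{\cdot i}e_i^T\\-\tfrac12e_iM_{\cdot i}^T&\tfrac12\left(e_iL_{i\cdot}+(e_iL_{i\cdot})^T\right)-(1+\mu_i)e_ie_i^T\end{bmatrix},$$ $$K_{l_i}=\begin{bmatrix}-M_{\cdot i}M_{\cdot i}^T&M_{\cdot i}(L_{i\cdot}-e_i^T)\\(L_{i\cdot}-e_i^T)^TM_{\cdot i}^T&-(L_{i\cdot}-e_i^T)^T(L_{i\cdot}-e_i^T)+l_i^2e_ie_i^T\end{bmatrix},$$ and $$\tilde S(\phi,\lambda,\psi,\gamma)=\begin{bmatrix}-\sum_i\phi_iK_{\mu_i}-\sum_i\lambda_iK_{l_i}+\psi K_I&\begin{bmatrix}\mathrm{Id}\\\gamma M^T\end{bmatrix}\\\begin{bmatrix}\mathrm{Id}&\gamma M\end{bmatrix}&\mathrm{Id}\end{bmatrix}\in\mathbb S^{d+n+d}.$$ $\mathbb S^m$ denotes the real symmetric $m\times m$ matrices and $\succeq$ the Loewner order. Bold matrices denote Kronecker lifts $\mathbf K=K\otimes\mathrm{Id}$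 acting on tuples of elements of $\mathcal H$, $\mathbf K^T=K^T\otimes\mathrm{Id}$. The operators $A_i$ are maximal monotone on $\mathcal H$, $\mathbf A(x_1,\dots,x_n)=A_1(x_1)\times\dots\times A_n(x_n)$, and $J_{\mathbf A}=(\mathrm{Id}+\mathbf A)^{-1}$. $A$ is $\mu$-strongly monotone if $\langle x-y,u-v\rangle\ge\mu\|x-y\|^2$ for $u\in A(x),v\in A(y)$ ($\mu=0$ permitted, meaning monotone). $\mathbf z_1^1$ and $\mathbf z_2^1$ are the results of one step of the iteration, with the same operators, from $\mathbf z_1^0$ and $\mathbf z_2^0$ respectively; the fixed-point equation for $\mathbf x^k$ is solved component by component using the triangular structure of $L$. The optimal value is the infimum of the minimization problem. *)

(* Defs.v *)
From HB Require Import structures.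
From mathcomp Require Import all_boot all_order all_algebra.
From mathcomp Require Import all_classical all_reals all_analysis.

Set Implicit Arguments.
Unset Strict Implicit.
Unset Printing Implicit Defensive.

Import Order.TTheory GRing.Theory Num.Theory.
Import numFieldNormedType.Exports.

Local Open Scope classical_set_scope.
Local Open Scope ring_scope.

Section Operators.
Context {R : realType} {H : completeNormedModType R}.

(* [{dot H for idfun}] is the type of real inner products on H; a real Hilbert
   space is a complete normed space whose norm comes from such a form. *)
Definition hilbert_norm (dot : {dot H for idfun}) : Prop :=
  forall x : H, `|x| ^+ 2 = dot x x.

Definition dim_ge (m : nat) : Prop :=
  exists e : 'I_m -> H,
    forall c : 'I_m -> R, \sum_i c i *: e i = 0 -> forall i, c i = 0.

(* A set-valued operator is a map A : H -> set H; [A x u] means u \in A(x). *)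

Definition strongly_monotone (dot : {dot H for idfun}) (mu : R)
    (A : H -> set H) : Prop :=
  forall x y u v, A x u -> A y v -> mu * `|x - y| ^+ 2 <= dot (x - y) (u - v).

Definition monotone (dot : {dot H for idfun}) (A : H -> set H) : Prop :=
  forall x y u v, A x u -> A y v -> 0 <= dot (x - y) (u - v).

Definition maximal_monotone (dot : {dot H for idfun}) (A : H -> set H) : Prop :=
  monotone dot A /\
  forall B : H -> set H,
    monotone dot B -> (forall x, A x `<=` B x) -> forall x, B x `<=` A x.

Definition lipschitz_op (l : R) (A : H -> set H) : Prop :=
  forall x y u v, A x u -> A y v -> `|u - v| <= l * `|x - y|.

(* Tuples in H^n are functions 'I_n -> H, with their pointwise module
   structure. *)

Definition tuple_sqnorm {n} (x : 'I_n -> H) : R := \sum_i `|x i| ^+ 2.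

Definition kron_id {p q} (K : 'M[R]_(p, q)) (x : 'I_q -> H) : 'I_p -> H :=
  fun i => \sum_j K i j *: x j.

Definition prod_op {n} (A : 'I_n -> H -> set H) (x : 'I_n -> H) :
    set ('I_n -> H) :=
  [set u | forall i, A i (x i) (u i)].

End Operators.

Arguments dim_ge {R} H m.

(* (Id + A)^-1 as a set-valued operator; x \in resolvent A y reads x = J_A(y),
   J_A being single-valued when A is monotone. *)
Definition resolvent {V : zmodType} (A : V -> set V) (y : V) : set V :=
  [set x | exists2 u, A x u & y = x + u].

(* The equation for x is implicit, since x occurs on both sides; with L lower
   triangular it can be solved one component after the other. *)
Definition iter_step {R : realType} {H : completeNormedModType R} {d n}
    (M : 'M[R]_(d, n)) (L : 'M[R]_n) (gamma : R) (A : 'I_n -> H -> set H)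
    (z z1 : 'I_d -> H) : Prop :=
  exists x : 'I_n -> H,
    resolvent (prod_op A) (- kron_id M^T z + kron_id L x) x /\
    z1 = z + gamma *: kron_id M x.

Definition contraction_factors {R : realType} {H : completeNormedModType R}
    (dot : {dot H for idfun}) {d n} (M : 'M[R]_(d, n)) (L : 'M[R]_n)
    (mu l : 'I_n -> R) (gamma : R) : set (\bar R) :=
  [set tau | exists (A : 'I_n -> H -> set H) (z10 z20 z11 z21 : 'I_d -> H),
    [/\ forall i, [/\ maximal_monotone dot (A i),
                      strongly_monotone dot (mu i) (A i) &
                      lipschitz_op (l i) (A i)],
        z10 <> z20,
        iter_step M L gamma A z10 z11,
        iter_step M L gamma A z20 z21 &
        tau = (tuple_sqnorm (z11 - z21) / tuple_sqnorm (z10 - z20))%:E]].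

(* The supremum is taken in the extended reals: it is -oo when there is no
   pair z10 <> z20, i.e. when H^d is trivial. *)
Definition worst_case_contraction {R : realType} {H : completeNormedModType R}
    (dot : {dot H for idfun}) {d n} (M : 'M[R]_(d, n)) (L : 'M[R]_n)
    (mu l : 'I_n -> R) (gamma : R) : \bar R :=
  ereal_sup (contraction_factors dot M L mu l gamma).

Section SemidefiniteProgram.
Context {R : realType} {d n : nat}.
Variables (M : 'M[R]_(d, n)) (L : 'M[R]_n) (mu l : 'I_n -> R).

Definition psd_mx {m} (S : 'M[R]_m) : Prop :=
  S^T = S /\ forall v : 'cV[R]_m, 0 <= (v^T *m S *m v) 0 0.

Definition bvec (i : 'I_n) : 'cV[R]_n := delta_mx i 0.

Definition K_I : 'M[R]_(d + n) := block_mx 1%:M 0 0 0.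

Definition K_mu (i : 'I_n) : 'M[R]_(d + n) :=
  block_mx
    0
    (- (2^-1 *: (col i M *m (bvec i)^T)))
    (- (2^-1 *: (bvec i *m (col i M)^T)))
    (2^-1 *: (bvec i *m row i L + (bvec i *m row i L)^T)
       - (1 + mu i) *: (bvec i *m (bvec i)^T)).

Definition K_l (i : 'I_n) : 'M[R]_(d + n) :=
  let r := row i L - (bvec i)^T in
  block_mx
    (- (col i M *m (col i M)^T))
    (col i M *m r)
    (r^T *m (col i M)^T)
    (- (r^T *m r) + (l i) ^+ 2 *: (bvec i *m (bvec i)^T)).

Definition S_tilde (phi lambda : 'I_n -> R) (psi gamma : R) :
    'M[R]_(d + n + d) :=
  block_mx
    (- (\sum_i phi i *: K_mu i) - \sum_i lambda i *: K_l i + psi *: K_I)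
    (col_mx 1%:M (gamma *: M^T))
    (row_mx 1%:M (gamma *: M))
    1%:M.

Definition D_feasible (phi lambda : 'I_n -> R) (psi gamma : R) : Prop :=
  [/\ psd_mx (S_tilde phi lambda psi gamma),
      forall i, 0 <= phi i & forall i, 0 <= lambda i].

(* The problem (D) is: minimize psi subject to [D_feasible phi lambda psi gamma].
   Its value is an infimum in the extended reals, not assumed attained. *)
Definition D_value_at (gamma : R) : \bar R :=
  ereal_inf [set psi%:E | psi in
    [set psi | exists phi lambda, D_feasible phi lambda psi gamma]].

Definition D_value : \bar R :=
  ereal_inf [set psi%:E | psi in
    [set psi | exists phi lambda gamma, D_feasible phi lambda psi gamma]].

Definition D_minimizer (phi lambda : 'I_n -> R) (psi gamma : R) : Prop :=
  D_feasible phi lambda psi gamma /\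
  forall phi' lambda' psi' gamma',
    D_feasible phi' lambda' psi' gamma' -> psi <= psi'.

End SemidefiniteProgram.

(* Main.v *)
Require Import Defs.
From mathcomp Require Import all_boot all_order all_algebra.
From mathcomp Require Import all_classical all_reals all_analysis.
From mathcomp Require Import ring lra.

Import Order.TTheory GRing.Theory Num.Theory.
Import numFieldNormedType.Exports.

Local Open Scope classical_set_scope.
Local Open Scope ring_scope.

(** The theorem is strong duality for a semidefinite program, combined with an
    interpolation theorem for monotone Lipschitz operators.

    Two runs of the iteration enter [tau] only through their differences [z]
    and [x] and through the residual [u = - M^T z + L x - x], the difference of
    the operator values.  Strong monotonicity and the Lipschitz condition say
    that the quadratic forms [<x_i, u_i> - mu_i |x_i|^2] and
    [l_i^2 |x_i|^2 - |u_i|^2], which are those of [K_mu i] and [K_l i], are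
    nonnegative: the pair [(z, x)] is [admissible].  Conversely, every
    admissible pair with [z <> 0] is realized: for each [i] there is an explicit
    linear operator, a multiple of the identity plus a skew operator of
    rank at most two, in the required class, which maps [0] to [0] and [x_i] to
    [u_i] ([operator_interpolation]).  Hence the worst-case contraction factor
    is the supremum of [|z + gamma M x|^2 / |z|^2] over the admissible pairs.

    Completing the square in the last block of variables shows that
    [S_tilde phi lambda psi gamma] is positive semidefinite exactly when so is
    the [pencil], the matrix of
    [psi |z|^2 - sum phi_i K_mu_i - sum lambda_i K_l_i - |z + gamma M x|^2]
    ([psd_S_tilde]).  A positive semidefinite matrix is a Gram matrix [B^T B]
    ([psd_factorization]), so its form is also nonnegative on tuples of vectors
    of the Hilbert space; this gives the upper bound ([dual_bound]).

    For tightness, let [p] bound the worst case, and let [eps > 0].  If a Gram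
    matrix of size [d + n] satisfies all constraints together with
    [|z + gamma M x|^2 >= (p + eps) |z|^2], then it vanishes: it is realized by
    vectors since [dim H >= d + n], so [z = 0] by the choice of [p], and then
    [x = 0] because the triangular system with diagonal entries below [1] has a
    unique solution ([admissible0]).  Positive semidefinite matrices of trace
    one form a compact convex set, so a theorem of the alternative
    ([conic_alternative]) turns this into multipliers which are feasible for the
    dual problem with value [p + eps].  The argument needs no Slater point
    for the Gram matrices, and none need exist: if [M = 0] then every admissible
    pair has [x = 0].  The price is that the multipliers are found for [p + eps]
    and not for [p] itself.

    Part (ii) holds because an infimum over all variables is the infimum over
    [gamma] of the infima over the remaining ones. *)

(** * Positive semidefinite matrices as Gram matrices *)

Section Cholesky.
Context {R : realType}.

Lemma quad_gram k m (P : 'M[R]_(k, m)) (v : 'cV[R]_m) :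
  0 <= (v^T *m (P^T *m P) *m v) 0 0.
Proof.
rewrite mulmxA -trmx_mul -mulmxA mxE sumr_ge0// => i _.
by rewrite mxE -expr2 sqr_ge0.
Qed.

Lemma tr_gram k m (P : 'M[R]_(k, m)) : (P^T *m P)^T = P^T *m P.
Proof. by rewrite trmx_mul trmxK. Qed.

(** The quadratic form of [S] at the vector with head [t] and tail [y]. *)
Lemma psd_block m (S : 'M[R]_(1 + m)) (t : R) (y : 'cV[R]_m) :
  psd_mx S ->
  0 <= S 0 0 * t ^+ 2 + 2 * t * (ursubmx S *m y) 0 0
       + (y^T *m drsubmx S *m y) 0 0.
Proof.
move=> [Ssym Spos]; have := Spos (col_mx t%:M y).
have Eb : dlsubmx S = (ursubmx S)^T by rewrite trmx_ursub Ssym.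
have Ea : ulsubmx S = (S 0 0)%:M.
  by rewrite [LHS]mx11_scalar !mxE !lshift0.
rewrite -{1}[S]submxK tr_col_mx mul_row_block mul_row_col Eb Ea tr_scalar_mx.
rewrite !mulmxDl !mul_scalar_mx -!scalemxAl.
rewrite (_ : y^T *m (ursubmx S)^T = ursubmx S *m y); last first.
  by rewrite -trmx_mul [RHS]mx11_scalar [in LHS](mx11_scalar (_ *m _)) tr_scalar_mx.
rewrite !mul_mx_scalar; move: (ursubmx S *m y) (_ *m drsubmx S *m y) => p q.
rewrite !mxE /= ?mulr1n; congr (_ <= _); ring.
Qed.

(** The Cholesky factorization, built one row at a time.  When the leading entry
    [a] vanishes so does the rest [b] of its row, and the same formula applies
    because [0^-1 = 0]. *)
Lemma psd_factorization m (S : 'M[R]_m) :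
  psd_mx S -> exists B : 'M[R]_m, S = B^T *m B.
Proof.
elim: m S => [|m IHm] S psdS.
  by exists 0; apply/matrixP => -[].
have /= blockS := (fun t y => @psd_block m S t y psdS).
have [Ssym _] := psdS.
pose a : R := @fun_of_matrix _ (1 + m) (1 + m) S 0 0.
pose b : 'rV[R]_m := @ursubmx _ 1 m 1 m S.
pose D : 'M[R]_m := @drsubmx _ 1 m 1 m S.
have {}blockS (t : R) (y : 'cV[R]_m) :
  0 <= a * t ^+ 2 + 2 * t * (b *m y) 0 0 + (y^T *m D *m y) 0 0.
  exact: blockS.
have a_ge0 : 0 <= a.
  by have := blockS 1 0; rewrite !mulmx0 !mxE; lra.
have Eb : (a * a^-1) *: b = b.
  have [a0|a_neq0] := eqVneq a 0; last by rewrite divff// scale1r.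
  rewrite a0 mul0r scale0r; apply/esym/rowP => j; rewrite [RHS]mxE.
  apply/eqP; apply: contraT => bj_neq0.
  (* With [a = 0] the form is affine in [t]; this [t] makes it equal to [-1]. *)
  have := blockS
    (- ((delta_mx j 0)^T *m D *m (delta_mx j 0 : 'cV_m) + 1%:M) 0 0 / (2 * b 0 j))
    (delta_mx j 0).
  rewrite a0 mul0r add0r (_ : (b *m _) 0 0 = b 0 j); last by rewrite -colE mxE.
  set q := (_ *m _ *m _); rewrite [(q + _) _ _]mxE [1%:M _ _]mxE /= -mulrA.
  rewrite (_ : 2 * _ = - (q 0 0 + 1)); first by lra.
  by field.
have [B' EB'] : exists B' : 'M[R]_m, D - a^-1 *: (b^T *m b) = B'^T *m B'.
  apply: IHm; split.
    by rewrite linearB linearZ /= trmx_mul trmxK trmx_drsub Ssym.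
  (* The minimizing head [t] for the given tail [y]. *)
  move=> y; have := blockS (- a^-1 * (b *m y) 0 0) y.
  have -> : (y^T *m (D - a^-1 *: (b^T *m b)) *m y) 0 0
      = (y^T *m D *m y) 0 0 - a^-1 * (b *m y) 0 0 ^+ 2.
    rewrite mulmxBr mulmxBl -scalemxAr -scalemxAl mulmxA -(mulmxA _ b) -trmx_mul.
    by rewrite [b *m y]mx11_scalar tr_scalar_mx mul_scalar_mx !mxE /= !mulr1n.
  move: Eb; have [->|a_neq0 _] := eqVneq a 0.
    by rewrite mul0r scale0r => <-; rewrite !mul0mx !mxE; lra.
  move: ((b *m y) 0 0) ((_ *m D *m y) 0 0) => p q h; apply: le_trans h _.
  rewrite le_eqVlt; apply/orP; left; apply/eqP; by field.
exists (block_mx (Num.sqrt a)%:M ((Num.sqrt a)^-1 *: b) 0 B').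
have EA : @ulsubmx _ 1 m 1 m S = a%:M.
  by rewrite [LHS]mx11_scalar !mxE !lshift0.
have Edl : @dlsubmx _ 1 m 1 m S = b^T by rewrite trmx_ursub Ssym.
rewrite -[S in LHS](@submxK _ 1 m 1 m) EA Edl -/b -/D.
rewrite (@tr_block_mx _ 1 m 1 m) (@mulmx_block _ 1 m 1 m 1 m) !tr_scalar_mx.
rewrite trmx0 !mul0mx mulmx0 !addr0 -EB'.
have Es : Num.sqrt a / Num.sqrt a = a * a^-1.
  have [->|a_neq0] := eqVneq a 0; first by rewrite sqrtr0 !mul0r.
  by rewrite !divff// sqrtr_eq0 -ltNge lt_def a_neq0.
have EsV : (Num.sqrt a)^-1 * (Num.sqrt a)^-1 = a^-1.
  by rewrite -expr2 exprVn sqr_sqrtr.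
congr (@block_mx _ 1 m 1 m _ _ _ _).
- by rewrite mul_scalar_mx scale_scalar_mx -expr2 sqr_sqrtr.
- by rewrite mul_scalar_mx scalerA Es Eb.
- by rewrite mul_mx_scalar linearZ /= scalerA Es -linearZ /= Eb.
- by rewrite [(_ *: b)^T]linearZ /= -scalemxAl -scalemxAr scalerA EsV addrC subrK.
Qed.

End Cholesky.

(** * A theorem of the alternative for quadratic forms *)

Section ConicAlternative.
Context {R : realType} {m : nat}.
Implicit Types (S B : 'M[R]_m).

(* The pairing of [S] with the Gram matrix [B^T B]; positive semidefinite
   matrices are handled through their factors [B], whose unit sphere is compact. *)
Let q S B : R := \tr (B *m S *m B^T).

Let q_gram S B : q S B = \tr (S *m (B^T *m B)).
Proof. by rewrite /q -mulmxA mxtrace_mulC -mulmxA. Qed.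

Let qZ (c : R) S B : q S (c *: B) = c ^+ 2 * q S B.
Proof.
by rewrite /q linearZ /= -!scalemxAl -scalemxAr scalerA linearZ /= expr2.
Qed.

Let q_sum (I : finType) (c : I -> R) (K : I -> 'M[R]_m) B :
  q (\sum_i c i *: K i) B = \sum_i c i * q (K i) B.
Proof.
rewrite q_gram mulmx_suml linear_sum /=; apply: eq_bigr => i _.
by rewrite -scalemxAl linearZ /= -q_gram.
Qed.

Let q1E B : q 1%:M B = \sum_i \sum_j B i j ^+ 2.
Proof.
rewrite /q mulmx1; apply: eq_bigr => i _; rewrite !mxE.
by apply: eq_bigr => j _; rewrite mxE expr2.
Qed.

Let q1_ge0 B : 0 <= q 1%:M B.
Proof. by rewrite q1E !sumr_ge0// => i _; rewrite sumr_ge0// => j _; rewrite sqr_ge0. Qed.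

(* The set of Gram matrices is convex. *)
Let q_convex (t : R) B1 B2 : 0 <= t <= 1 ->
  exists B, forall S, q S B = (1 - t) * q S B1 + t * q S B2.
Proof.
move=> /andP[t0 t1].
have [B EB] : exists B, (1 - t) *: (B1^T *m B1) + t *: (B2^T *m B2) = B^T *m B.
  apply: psd_factorization; split.
    by rewrite linearD !linearZ /= !trmx_mul !trmxK.
  move=> v; rewrite mulmxDr mulmxDl -!scalemxAr -!scalemxAl.
  rewrite mxE [X in X + _]mxE [X in _ + X]mxE.
  by rewrite addr_ge0// mulr_ge0 ?quad_gram// subr_ge0.
exists B => S; rewrite !q_gram -EB mulmxDr -!scalemxAr linearD /=.
by rewrite !linearZ.
Qed.

Let q_rank1 (v : 'cV[R]_m) :
  exists B, forall S, q S B = (v^T *m S *m v) 0 0.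
Proof.
have [B EB] : exists B, v *m v^T = B^T *m B.
  apply: psd_factorization; split; first by rewrite trmx_mul trmxK.
  move=> w; rewrite mulmxA -mulmxA mxE big_ord1.
  rewrite (_ : w^T *m v = (v^T *m w)^T); last by rewrite trmx_mul trmxK.
  by rewrite mxE -expr2 sqr_ge0.
exists B => S; rewrite q_gram -EB mulmxA mxtrace_mulC mulmxA.
by rewrite [LHS]big_ord1.
Qed.

Let q_continuous S :
  continuous (fun v : 'rV[R]_(m * m) => q S (vec_mx v)).
Proof.
have -> : (fun v : 'rV[R]_(m * m) => q S (vec_mx v)) =
  (fun v => \sum_i \sum_j (\sum_k v 0 (mxvec_index i k) * S k j)
                          * v 0 (mxvec_index i j)).
  apply/funext => v; apply: eq_bigr => i _; rewrite mxE.
  apply: eq_bigr => j _; rewrite !mxE; congr (_ * _).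
  by apply: eq_bigr => k _; rewrite !mxE.
apply: continuous_big => [|i _]; first exact: add_continuous.
apply: continuous_big => [|j _]; first exact: add_continuous.
move=> v; apply: continuousM; last exact: coord_continuous.
apply: continuous_big => [|k _]; first exact: add_continuous.
move=> w; apply: continuousM; first exact: coord_continuous.
exact: cst_continuous.
Qed.

Let sphere : set 'rV[R]_(m * m) := [set v | q 1%:M (vec_mx v) = 1].

Let sphere_compact : compact sphere.
Proof.
apply: bounded_closed_compact.
  exists 1; split => // x x1 v /= sv.
  rewrite (le_trans _ (ltW x1))//.
  have -> : `|v| = mx_norm v by [].
  have [->//|/mx_norm_neq0[[i j] /= ->]] := eqVneq (mx_norm v) 0.
  case/mxvec_indexP: j => a b; rewrite ord1.
  rewrite -(ler_pXn2r (n:=2))// ?nnegrE// expr1n -normrX ger0_norm ?sqr_ge0//.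
  rewrite -sv q1E (bigD1 a)//= (bigD1 b)//= mxE -addrA lerDl addr_ge0//.
    by rewrite sumr_ge0// => j _; rewrite sqr_ge0.
  by rewrite sumr_ge0// => j _; rewrite sumr_ge0// => k _; rewrite sqr_ge0.
have -> : sphere = (fun v => q 1%:M (vec_mx v)) @^-1` [set 1] by [].
apply: preimage_closed; last exact: closed_eq.
by move=> v _; exact: q_continuous.
Qed.

Lemma le0_of_le_small (a b : R) :
  (forall t, 0 < t <= 1 -> 2 * a <= t * b) -> a <= 0.
Proof.
move=> h; rewrite leNgt; apply/negP => a0.
have := h 1; rewrite ltr01 lexx mul1r => /(_ isT) ab.
have b0 : 0 < b by lra.
have := h (a / b); rewrite divr_gt0//= ler_pdivrMr// divfK ?gt_eqF// mul1r.
by move=> /(_ ltac:(lra)); lra.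
Qed.

(** If only the zero Gram matrix pairs nonnegatively with all the [K i], then some
    nonnegative combination of the [K i], with a positive weight on a prescribed
    index, is negative semidefinite.

    On the unit sphere of factors [B], minimize the squared distance of the
    vector of the [q (K i) B] to the nonnegative orthant.  The displacement
    [lam] at a minimizer separates the orthant strictly from the convex set of
    all these vectors, which leaves room to increase the weight of [i0]. *)
Lemma conic_alternative (I : finType) (K : I -> 'M[R]_m) (i0 : I) :
  (forall B : 'M[R]_m, (forall i, 0 <= \tr (B *m K i *m B^T)) -> B = 0) ->
  exists lam : I -> R, [/\ forall i, 0 <= lam i, 0 < lam i0 &
    forall v : 'cV[R]_m, (v^T *m (\sum_i lam i *: K i) *m v) 0 0 <= 0].
Proof.
move=> hK; have [m0|m_gt0] := posnP m.
  exists (fun=> 1); split=> // v.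
  have -> : v = 0 by apply/matrixP => -[i hi]; exfalso; move: hi; rewrite m0.
  by rewrite mulmx0 mxE.
have normalize B : B != 0 -> exists2 c, 0 < c &
    exists2 v, sphere v & forall S, q S B = c * q S (vec_mx v).
  move=> B0; have qB0 : 0 < q 1%:M B.
    rewrite lt_def q1_ge0 andbT; apply: contraNneq B0 => qB.
    apply/eqP/matrixP => i j; rewrite mxE; apply/eqP; rewrite -sqrf_eq0.
    rewrite eq_le sqr_ge0 andbT -qB q1E (bigD1 i)//= (bigD1 j)//= -addrA lerDl.
    rewrite addr_ge0//; first by rewrite sumr_ge0// => k _; rewrite sqr_ge0.
    by rewrite sumr_ge0// => k _; rewrite sumr_ge0// => l _; rewrite sqr_ge0.
  have qV S : q S ((Num.sqrt (q 1%:M B))^-1 *: B) = (q 1%:M B)^-1 * q S B.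
    by rewrite qZ exprVn sqr_sqrtr// ltW.
  exists (q 1%:M B) => //; exists (mxvec ((Num.sqrt (q 1%:M B))^-1 *: B)).
    by rewrite /sphere /= mxvecK qV mulVf// gt_eqF.
  by move=> S; rewrite mxvecK qV mulrA divff ?mul1r// gt_eqF.
have sphere_neq0 : sphere !=set0.
  have /normalize[_ _ [v sv _]] : 1%:M != 0 :> 'M[R]_m.
    apply/eqP => /matrixP/(_ (Ordinal m_gt0) (Ordinal m_gt0)).
    by rewrite !mxE eqxx => /eqP; rewrite oner_eq0.
  by exists v.
(* The negative part. *)
pose neg (x : R) := Num.max (- x) 0.
have neg_ge0 x : 0 <= neg x by rewrite /neg le_max lexx orbT.
have neg_lb x : - x <= neg x by rewrite /neg le_max lexx.
have negM x : neg x * x = - neg x ^+ 2.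
  by rewrite /neg; case: leP => _; rewrite ?expr2; ring.
have neg_le x y : 0 <= y -> neg x ^+ 2 <= (y - x) ^+ 2.
  move=> y0; rewrite /neg; have [x0|x0] := leP (- x) 0; first by rewrite expr0n sqr_ge0.
  by rewrite ler_pXn2r// ?nnegrE; lra.
pose f v := \sum_i neg (q (K i) (vec_mx v)) ^+ 2.
have f_cont : continuous f.
  apply: continuous_big => [|i _]; first exact: add_continuous.
  move=> v; apply: (@continuous_comp _ _ _ (fun v => neg (q (K i) (vec_mx v)))
    (fun y => y ^+ 2)); last exact: exprn_continuous.
  apply: (@continuous_max R _ (fun v => - q (K i) (vec_mx v)) (fun=> 0)).
    by apply: continuousN; exact: q_continuous.
  exact: cst_continuous.
have [c /set_mem sc cmin] := compact_EVT_min sphere_neq0 sphere_compact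
  (continuous_subspaceT f_cont).
pose lam i := neg (q (K i) (vec_mx c)).
have s_gt0 : 0 < f c.
  rewrite lt_def /f sumr_ge0 ?andbT => [|i _]; last exact: sqr_ge0.
  apply/negP => /eqP fc0.
  have c0 : vec_mx c = 0.
    apply: hK => i.
    have /eqP : neg (q (K i) (vec_mx c)) ^+ 2 = 0.
      by apply/eqP; rewrite (psumr_eq0P _ fc0)// => j _; exact: sqr_ge0.
    by rewrite sqrf_eq0 => /eqP neg0; have := neg_lb (q (K i) (vec_mx c)); rewrite neg0 /q; lra.
  by move: sc; rewrite /sphere/= c0 /q !mul0mx linear0 => /esym/eqP; rewrite oner_eq0.
(* The variational inequality at the minimizer, along segments of Gram
   matrices. *)
have lam_lt v : sphere v -> \sum_i lam i * q (K i) (vec_mx v) <= - f c.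
  move=> sv.
  pose del i := q (K i) (vec_mx v) - q (K i) (vec_mx c).
  have : \sum_i lam i * del i <= 0.
    apply: (@le0_of_le_small _ (\sum_i del i ^+ 2)) => t /andP[t0 t1].
    have [B EB] := @q_convex t (vec_mx c) (vec_mx v) ltac:(lra).
    have sB : sphere (mxvec B).
      by rewrite /sphere/= mxvecK EB sc sv; lra.
    have := cmin _ (mem_set sB).
    have : f (mxvec B) <= \sum_i (lam i - t * del i) ^+ 2.
      apply: ler_sum => i _; rewrite mxvecK EB /del.
      have := @neg_le ((1 - t) * q (K i) (vec_mx c) + t * q (K i) (vec_mx v))
        (lam i + q (K i) (vec_mx c)).
      have -> : 0 <= lam i + q (K i) (vec_mx c).
        by have := neg_lb (q (K i) (vec_mx c)); rewrite /lam; lra.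
      move=> /(_ isT)/le_trans; apply; rewrite le_eqVlt; apply/orP; left.
      by apply/eqP; ring.
    have -> : \sum_i (lam i - t * del i) ^+ 2 =
        f c - t * (2 * \sum_i lam i * del i) + t ^+ 2 * \sum_i del i ^+ 2.
      rewrite !mulr_sumr -sumrB -big_split /=; apply: eq_bigr => i _.
      by rewrite /lam; ring.
    move=> /[swap]/le_trans/[apply].
    rewrite -addrA lerDl addrC expr2 -mulrA -mulrBr pmulr_rge0//.
    by rewrite subr_ge0.
  rewrite /f -sumrN; under eq_bigr do rewrite mulrBr.
  rewrite sumrB subr_le0 => /le_trans; apply.
  by apply: ler_sum => i _; rewrite negM.
have [w _ wmax] := compact_EVT_max sphere_neq0 sphere_compact
  (continuous_subspaceT (@q_continuous (K i0))).
(* The weight added to [lam i0] uses up at most the strict margin [f c]. *)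
pose e := f c / (1 + `|q (K i0) (vec_mx w)|).
have e_gt0 : 0 < e by rewrite divr_gt0// ltr_pwDl.
exists (fun i => lam i + e *+ (i == i0)); split.
- by move=> i; rewrite addr_ge0 ?mulrn_wge0 ?neg_ge0// ltW.
- by rewrite eqxx ltr_wpDl ?neg_ge0.
move=> v; have [B EB] := q_rank1 v; rewrite -EB.
have [->|/normalize[a a0 [u su ->]]] := eqVneq B 0.
  by rewrite /q !mul0mx linear0.
rewrite pmulr_rle0// q_sum; under eq_bigr do rewrite mulrDl.
rewrite big_split /= [X in _ + X](bigD1 i0)//= eqxx [X in _ + (_ + X)]big1; last first.
  by move=> i /negPf ->; rewrite mul0r.
rewrite addr0 mulr1n.
have : e * q (K i0) (vec_mx u) <= f c.
  rewrite /e mulrAC ler_pdivrMr ?ltr_pwDl// ler_pM2l//.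
  have := wmax u (mem_set su); have := ler_norm (q (K i0) (vec_mx w)); lra.
have := lam_lt u su; lra.
Qed.

End ConicAlternative.

(** * Quadratic forms on tuples of vectors *)

Section GramForms.
Context {R : realType} {H : completeNormedModType R}.
Variable (dot : {dot H for idfun}).

Lemma dotC x y : dot x y = dot y x.
Proof. by rewrite hermC /= expr0 mul1r. Qed.

Lemma dotDl x y z : dot (x + y) z = dot x z + dot y z.
Proof. exact: linearDl. Qed.

Lemma dotDr x y z : dot x (y + z) = dot x y + dot x z.
Proof. by rewrite dotC dotDl !(dotC x). Qed.

Lemma dotZl a x y : dot (a *: x) y = a * dot x y.
Proof. exact: linearZl_LR. Qed.

Lemma dotZr a x y : dot x (a *: y) = a * dot x y.
Proof. by rewrite dotC dotZl dotC. Qed.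

Lemma dot0l x : dot 0 x = 0.
Proof. by rewrite -[0](scale0r 0) dotZl mul0r. Qed.

Lemma dot0r x : dot x 0 = 0.
Proof. by rewrite dotC dot0l. Qed.

Lemma dotNl x y : dot (- x) y = - dot x y.
Proof. by rewrite -scaleN1r dotZl mulN1r. Qed.

Lemma dotNr x y : dot x (- y) = - dot x y.
Proof. by rewrite dotC dotNl dotC. Qed.

Lemma dot_suml (I : Type) (r : seq I) (F : I -> H) y :
  dot (\sum_(i <- r) F i) y = \sum_(i <- r) dot (F i) y.
Proof.
by elim/big_rec2: _ => [|i a b _ <-]; rewrite ?dot0l// dotDl.
Qed.

Lemma dot_sumr (I : Type) (r : seq I) (F : I -> H) y :
  dot y (\sum_(i <- r) F i) = \sum_(i <- r) dot y (F i).
Proof. by rewrite dotC dot_suml; apply: eq_bigr => i _; rewrite dotC. Qed.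

(* Multi-rule expanding an inner product by bilinearity. *)
Definition dotE := (dotDl, dotDr, dotNl, dotNr, dotZl, dotZr).

(** The quadratic form of the lift of [K] to tuples of vectors, that is, the
    pairing of [K] with the Gram matrix of [w]. *)
Definition gram_form {m} (K : 'M[R]_m) (w : 'I_m -> H) : R :=
  \sum_i \sum_j K i j * dot (w i) (w j).

Lemma gram_formD m (K1 K2 : 'M[R]_m) w :
  gram_form (K1 + K2) w = gram_form K1 w + gram_form K2 w.
Proof.
rewrite /gram_form -big_split /=; apply: eq_bigr => i _.
by rewrite -big_split /=; apply: eq_bigr => j _; rewrite mxE mulrDl.
Qed.

Lemma gram_formZ m a (K : 'M[R]_m) w : gram_form (a *: K) w = a * gram_form K w.
Proof.
rewrite /gram_form mulr_sumr; apply: eq_bigr => i _.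
by rewrite mulr_sumr; apply: eq_bigr => j _; rewrite mxE mulrA.
Qed.

Lemma gram_formN m (K : 'M[R]_m) w : gram_form (- K) w = - gram_form K w.
Proof. by rewrite -scaleN1r gram_formZ mulN1r. Qed.

Lemma gram_form_sum m (I : Type) (r : seq I) (K : I -> 'M[R]_m) w :
  gram_form (\sum_(i <- r) K i) w = \sum_(i <- r) gram_form (K i) w.
Proof.
elim/big_rec2: _ => [|i a b _ <-]; last by rewrite gram_formD.
by rewrite -(scale0r 0) gram_formZ mul0r.
Qed.

Lemma gram_form_mul k m (P Q : 'M[R]_(k, m)) w :
  gram_form (P^T *m Q) w = \sum_i dot (kron_id P w i) (kron_id Q w i).
Proof.
transitivity (\sum_i \sum_j \sum_l P l i * Q l j * dot (w i) (w j)).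
  apply: eq_bigr => i _; apply: eq_bigr => j _; rewrite mxE mulr_suml.
  by apply: eq_bigr => l _; rewrite mxE.
under eq_bigr do rewrite exchange_big /=.
rewrite exchange_big /=; apply: eq_bigr => l _.
rewrite dot_suml; apply: eq_bigr => i _; rewrite dot_sumr; apply: eq_bigr => j _.
by rewrite dotZl dotZr mulrA.
Qed.

Lemma psd_gram_form_ge0 m (S : 'M[R]_m) w : hilbert_norm dot ->
  psd_mx S -> 0 <= gram_form S w.
Proof.
move=> hdot /psd_factorization[B ->]; rewrite gram_form_mul sumr_ge0// => i _.
by rewrite -hdot sqr_ge0.
Qed.

Definition orthonormal_family {m} (e : 'I_m -> H) : Prop :=
  forall i j, dot (e i) (e j) = (i == j)%:R.

Lemma dot_kron_id k m (B : 'M[R]_(k, m)) (e : 'I_k -> H) i j :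
  dot (kron_id B^T e i) (kron_id B^T e j)
  = (B^T *m (\matrix_(a, b) dot (e a) (e b)) *m B) i j.
Proof.
rewrite dot_sumr mxE; apply: eq_bigr => b _.
rewrite dotZr dot_suml [X in X * _ = _]mxE mulrC; congr (_ * _).
by rewrite [RHS]mxE; apply: eq_bigr => a _; rewrite dotZl; congr (_ * _); rewrite mxE.
Qed.

(** The columns of [B], read as vectors in an orthonormal frame, have Gram matrix
    [B^T B]. *)
Lemma gram_form_orthonormal m (e : 'I_m -> H) (B K : 'M[R]_m) :
  orthonormal_family e -> gram_form K (kron_id B^T e) = \tr (B *m K *m B^T).
Proof.
move=> he; rewrite -mulmxA mxtrace_mulC -mulmxA mxtrace_mulC.
transitivity (\sum_i \sum_j K i j * (B^T *m B) j i).
  apply: eq_bigr => i _; apply: eq_bigr => j _; congr (_ * _).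
  rewrite dotC dot_kron_id (_ : \matrix_(a, b) _ = 1%:M) ?mulmx1//.
  by apply/matrixP => a b; rewrite !mxE he.
by rewrite mxtrace_mulC; apply: eq_bigr => i _; rewrite mxE.
Qed.

(** Orthonormalization of a free family [e]: if its Gram matrix is [B^T B], then
    [B] is invertible and its inverse is the change of basis. *)
Lemma orthonormal_exists m : hilbert_norm dot -> dim_ge H m ->
  exists e : 'I_m -> H, orthonormal_family e.
Proof.
move=> hdot [e efree]; pose G : 'M[R]_m := \matrix_(a, b) dot (e a) (e b).
have Gquad (v : 'cV[R]_m) : (v^T *m G *m v) 0 0 = `|\sum_i v i 0 *: e i| ^+ 2.
  rewrite hdot (_ : \sum_i _ = kron_id v^T e 0) ?dot_kron_id//.
  by apply: eq_bigr => i _; rewrite mxE.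
have [|B EB] := @psd_factorization _ _ G.
  split; first by apply/matrixP => i j; rewrite !mxE dotC.
  by move=> v; rewrite Gquad sqr_ge0.
have Bunit : B \in unitmx.
  rewrite -unitmx_tr -row_free_unit -kermx_eq0; apply/eqP/row_matrixP => i.
  rewrite row0; set v := row i _.
  have vB : v *m B^T = 0 by rewrite -row_mul mulmx_ker row0.
  have := Gquad v^T; rewrite EB trmxK mulmxA vB !mul0mx mxE => /esym/eqP.
  rewrite sqrf_eq0 normr_eq0 => /eqP/efree v0.
  by apply/rowP => j; have := v0 j; rewrite !mxE.
exists (kron_id (invmx B)^T e) => i j; rewrite dot_kron_id -/G EB.
rewrite mulmxA -mulmxA mulmxV// mulmx1 -trmx_mul mulmxV// trmx1.
by rewrite mxE.
Qed.

End GramForms.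

(** * Interpolation by strongly monotone Lipschitz operators *)

Section Interpolation.
Context {R : realType} {H : completeNormedModType R}.
Variable (dot : {dot H for idfun}).
Hypothesis (hdot : hilbert_norm dot).

(** Adding a skew operator [J] to [a *: id] does not change the form
    [<v, A v> = a |v|^2], while [|A v|^2 = a^2 |v|^2 + |J v|^2].  Maximality
    comes from the operator being additive and defined everywhere. *)
Lemma scaled_id_plus_skew_class (a b mu l : R) (J : H -> H)
    (A := fun v => [set a *: v + J v]) :
  0 <= mu <= a -> 0 <= l -> a ^+ 2 + b <= l ^+ 2 ->
  (forall v w, J (v - w) = J v - J w) ->
  (forall v, dot v (J v) = 0) ->
  (forall v, `|J v| ^+ 2 <= b * `|v| ^+ 2) ->
  [/\ maximal_monotone dot A, strongly_monotone dot mu A & lipschitz_op l A].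
Proof.
move=> /andP[mu0 mua] l0 abl JB Jskew Jb.
have TB v w : (a *: v + J v) - (a *: w + J w) = a *: (v - w) + J (v - w).
  by rewrite JB scalerBr opprD addrACA.
have dotT v : dot v (a *: v + J v) = a * `|v| ^+ 2.
  by rewrite dotDr Jskew addr0 dotZr hdot.
have Tmono v w : dot (v - w) ((a *: v + J v) - (a *: w + J w)) = a * `|v - w| ^+ 2.
  by rewrite TB dotT.
split.
- split=> [x y _ _ -> ->|B Bmono AB x w Bxw].
    by rewrite Tmono mulr_ge0 ?sqr_ge0// (le_trans mu0).
  pose h := w - (a *: x + J x); pose t := (a + 1)^-1.
  have t0 : 0 < t by rewrite invr_gt0; lra.
  have at1 : a * t < 1 by rewrite ltr_pdivrMr; lra.
  (* Testing monotonicity against the point [x + t h] forces [h = 0]. *)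
  have := Bmono _ _ _ _ Bxw (AB (x + t *: h) _ erefl).
  have -> : w - (a *: (x + t *: h) + J (x + t *: h))
      = h - (a *: (t *: h) + J (t *: h)).
    have := TB (x + t *: h) x; rewrite [x + _ - x]addrAC subrr add0r => /(canRL (subrK _)) ->.
    by rewrite opprD addrA addrAC.
  rewrite opprD addNKr dotNl dotDr dotNr dotT dotZl -hdot normrZ gtr0_norm//.
  rewrite exprMn => ht.
  have {}ht : t * (1 - a * t) * `|h| ^+ 2 <= 0 by lra.
  have : `|h| ^+ 2 <= 0 by rewrite -(pmulr_rle0 _ (x := t * (1 - a * t)))// mulr_gt0// subr_gt0.
  by rewrite real_exprn_even_le0 ?num_real//= normr_eq0 subr_eq0 => /eqP ->.
- by move=> x y _ _ -> ->; rewrite Tmono ler_wpM2r ?sqr_ge0.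
- move=> x y _ _ -> ->; rewrite TB.
  rewrite -(ler_pXn2r (n:=2))// ?nnegrE ?mulr_ge0// exprMn.
  move: (x - y) => v; rewrite hdot !dotE.
  rewrite (dotC _ (J v) v) Jskew -!hdot.
  have := Jb v; have := sqr_ge0 `|v|; nra.
Qed.

(** If [x] is not zero, decompose [u = a x + y] with [y] orthogonal to [x].  The
    operator is [a] times the identity plus the skew operator which maps [x] to
    [y] and vanishes on the orthogonal complement of [x] and [y].  If [x = 0]
    then [u = 0], and [mu] times the identity will do. *)
Lemma operator_interpolation (mu l : R) (x u : H) :
  0 <= mu <= l -> mu * `|x| ^+ 2 <= dot x u -> `|u| <= l * `|x| ->
  exists A : H -> set H,
    [/\ [/\ maximal_monotone dot A, strongly_monotone dot mu A & lipschitz_op l A],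
        A 0 0 & A x u].
Proof.
move=> /andP[mu0 mul] hmono hlip; have l0 := le_trans mu0 mul.
have [x0|x_neq0] := eqVneq x 0.
  have u0 : u = 0 by apply/eqP; rewrite -normr_le0 (le_trans hlip)// x0 normr0 mulr0.
  exists (fun v => [set mu *: v + 0]); split.
  - apply: (@scaled_id_plus_skew_class mu 0 mu l (fun=> 0)) => //.
    + by rewrite mu0 lexx.
    + by rewrite addr0 ler_pXn2r ?nnegrE.
    + by move=> _ _; rewrite subr0.
    + by move=> v; rewrite dot0r.
    + by move=> v; rewrite normr0 expr0n mul0r.
  - by rewrite /= scaler0 addr0.
  - by rewrite x0 u0 /= scaler0 addr0.
pose s := `|x| ^+ 2.
have s0 : 0 < s by rewrite exprn_gt0// normr_gt0.
pose a := dot x u / s.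
have [y Eu xy] : exists2 y, u = a *: x + y & dot x y = 0.
  exists (u - a *: x); first by rewrite addrC subrK.
  by rewrite !dotE -hdot -/s /a; field; rewrite gt_eqF.
pose Y := `|y| ^+ 2.
have Y0 : 0 <= Y by exact: sqr_ge0.
have EuY : `|u| ^+ 2 = a ^+ 2 * s + Y.
  by rewrite Eu hdot !dotE (dotC _ y x) xy -!hdot -/s -/Y; ring.
pose J v := s^-1 *: (dot v x *: y - dot v y *: x).
have EJ v : `|J v| ^+ 2 = s^-1 ^+ 2 * (dot v x ^+ 2 * Y + dot v y ^+ 2 * s).
  by rewrite hdot !dotE (dotC _ y x) xy -!hdot -/s -/Y; ring.
(* Bessel's inequality for the orthogonal pair [x], [y], cleared of
   denominators. *)
have bessel v : dot v x ^+ 2 * Y + dot v y ^+ 2 * s <= s * Y * `|v| ^+ 2.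
  have [Y_eq0|Y_neq0] := eqVneq Y 0.
    have -> : y = 0 by apply/eqP; rewrite -normr_eq0 -sqrf_eq0 -/Y Y_eq0.
    by rewrite Y_eq0 dot0r expr0n !(mulr0, mul0r) addr0.
  have Y_gt0 : 0 < Y by rewrite lt_def Y_neq0.
  have := sqr_ge0 `|(s * Y) *: v - (dot v x * Y) *: x - (dot v y * s) *: y|.
  rewrite hdot !dotE (dotC _ y x) xy (dotC _ y v) (dotC _ x v) -!hdot -/s -/Y.
  move=> h; rewrite -subr_ge0 -(pmulr_rge0 _ (mulr_gt0 s0 Y_gt0)).
  apply: le_trans h _; rewrite le_eqVlt; apply/orP; left; apply/eqP; ring.
exists (fun v => [set a *: v + J v]); split.
- apply: (@scaled_id_plus_skew_class a (Y / s) mu l J) => //.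
  + by rewrite mu0 ler_pdivlMr.
  + rewrite -(ler_pM2r s0) mulrDl divfK ?gt_eqF// -EuY -exprMn.
    by rewrite ler_pXn2r ?nnegrE// mulr_ge0.
  + move=> v w; rewrite /J -scalerBr !dotE !scalerBl !opprB.
    by congr (_ *: _); rewrite addrACA [RHS]addrACA [X in _ + X = _]addrC.
  + by move=> v; rewrite /J !dotE; ring.
  + move=> v; rewrite EJ expr2 -mulrA mulrC ler_pdivrMr//.
    rewrite ler_pdivrMl// (le_trans (bessel v))// le_eqVlt.
    by apply/orP; left; apply/eqP; field; rewrite gt_eqF.
- by rewrite /= /J !dot0l !scale0r subr0 !scaler0 addr0.
- rewrite /= /J -hdot -/s xy scale0r subr0 scalerA mulVf ?gt_eqF// scale1r.
  exact: Eu.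
Qed.

End Interpolation.

(** * The Schur complement of the dual constraint *)

Section Pencil.
Context {R : realType} {d n : nat}.
Variables (M : 'M[R]_(d, n)) (L : 'M[R]_n) (mu l : 'I_n -> R).

(** The row which extracts [x_i] from the pair [(z, x)]. *)
Definition x_row (i : 'I_n) : 'rV[R]_(d + n) := row_mx 0 (bvec i)^T.

(** The row which computes the [i]th component of [- M^T z + L x - x]. *)
Definition u_row (i : 'I_n) : 'rV[R]_(d + n) :=
  row_mx (- (col i M)^T) (row i L - (bvec i)^T).

(** The matrix which extracts [z] from the pair [(z, x)]. *)
Definition z_mx : 'M[R]_(d, d + n) := row_mx 1%:M 0.

(** The matrix which computes the updated variable [z + gamma M x]. *)
Definition step_mx (gamma : R) : 'M[R]_(d, d + n) := row_mx 1%:M (gamma *: M).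

Lemma K_I_factor : K_I = z_mx^T *m z_mx.
Proof.
by rewrite /K_I /z_mx tr_row_mx mul_col_row trmx1 trmx0 mulmx1 mulmx0 mul0mx mulmx0.
Qed.

Lemma K_l_factor i :
  K_l M L l i = l i ^+ 2 *: ((x_row i)^T *m x_row i) - (u_row i)^T *m u_row i.
Proof.
rewrite /K_l /x_row /u_row !tr_row_mx !mul_col_row scale_block_mx opp_block_mx.
rewrite add_block_mx; congr block_mx.
- by rewrite trmx0 mul0mx scaler0 add0r [(- _)^T]linearN /= mulNmx mulmxN !trmxK opprK.
- by rewrite trmx0 mul0mx scaler0 add0r [(- _)^T]linearN /= mulNmx opprK trmxK.
- by rewrite mulmx0 scaler0 add0r mulmxN opprK.
- by rewrite trmxK addrC.
Qed.

Lemma K_mu_factor i :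
  K_mu M L mu i
  = 2^-1 *: ((x_row i)^T *m u_row i + (u_row i)^T *m x_row i)
    - mu i *: ((x_row i)^T *m x_row i).
Proof.
rewrite /K_mu /x_row /u_row !tr_row_mx !mul_col_row !scale_block_mx opp_block_mx.
rewrite !add_block_mx scale_block_mx add_block_mx; congr block_mx.
- by rewrite trmx0 !(mul0mx, mulmx0, addr0, scaler0, subr0).
- by rewrite trmx0 !mul0mx add0r scaler0 subr0 [(- _)^T]linearN /= trmxK mulNmx scalerN.
- by rewrite !mulmx0 addr0 scaler0 subr0 mulmxN scalerN trmxK.
- rewrite !trmxK mulmxBr [(_ - _)^T]linearB /= !trmxK mulmxBl trmx_mul.
  rewrite addrACA -opprD scalerBr scalerDl scale1r opprD addrA; congr (_ - _ - _).
  by rewrite scalerDr -scalerDl -[LHS]scale1r; congr (_ *: _); field.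
Qed.

(** The Schur complement of the last diagonal block in [S_tilde]. *)
Definition pencil (phi lambda : 'I_n -> R) (psi gamma : R) : 'M[R]_(d + n) :=
  psi *: K_I - \sum_i phi i *: K_mu M L mu i - \sum_i lambda i *: K_l M L l i
  - (step_mx gamma)^T *m step_mx gamma.

Lemma pencil_sym phi lambda psi gamma :
  (pencil phi lambda psi gamma)^T = pencil phi lambda psi gamma.
Proof.
rewrite /pencil !linearB /= tr_gram linearZ /= K_I_factor tr_gram !linear_sum /=.
congr (_ + _ + _ - _); apply: eq_bigr => i _; congr (- _); rewrite linearZ /=; congr (_ *: _).
  rewrite K_mu_factor linearB !linearZ /= tr_gram linearD /= !trmx_mul !trmxK.
  by rewrite [X in _ *: X]addrC.
by rewrite K_l_factor linearB linearZ /= !tr_gram.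
Qed.

Lemma S_tilde_block phi lambda psi gamma :
  S_tilde M L mu l phi lambda psi gamma
  = block_mx (pencil phi lambda psi gamma + (step_mx gamma)^T *m step_mx gamma)
      (step_mx gamma)^T (step_mx gamma) 1%:M.
Proof.
rewrite /S_tilde /pencil subrK; congr block_mx.
  by rewrite addrC addrA.
by rewrite /step_mx tr_row_mx trmx1 linearZ.
Qed.

Lemma psd_S_tilde phi lambda psi gamma :
  psd_mx (S_tilde M L mu l phi lambda psi gamma)
  <-> psd_mx (pencil phi lambda psi gamma).
Proof.
rewrite S_tilde_block; set P := pencil _ _ _ _; set W := step_mx _.
have Psym : P^T = P by exact: pencil_sym.
clearbody P W.
(* Completing the square in the last block of variables. *)
have square (w : 'cV_(d + n)) (y : 'cV_d) :
    (col_mx w y)^T *m block_mx (P + W^T *m W) W^T W 1%:M *m col_mx w y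
    = w^T *m P *m w + (W *m w + y)^T *m (W *m w + y).
  rewrite tr_col_mx mul_row_block mul_row_col mulmx1.
  rewrite [(W *m w + y)^T]linearD /= trmx_mul !(mulmxDl, mulmxDr) !mulmxA.
  by rewrite !addrA.
split=> [[_ pos]|[_ pos]]; split.
- exact: Psym.
- move=> w; have := pos (col_mx w (- (W *m w))).
  by rewrite square subrr mulmx0 addr0.
- by rewrite tr_block_mx linearD /= Psym tr_gram trmxK trmx1.
- move=> v; rewrite -[v]vsubmxK square mxE addr_ge0//.
  rewrite -[X in 0 <= (X *m _) 0 0]mulmx1 -[1%:M]mulmx1 -{1}trmx1; exact: quad_gram.
Qed.

End Pencil.

(** * The constraint forms evaluated on vectors *)

Section StackedForms.
Context {R : realType} {H : completeNormedModType R} {d n : nat}.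
Variable (dot : {dot H for idfun}).
Hypothesis (hdot : hilbert_norm dot).
Variables (M : 'M[R]_(d, n)) (L : 'M[R]_n) (mu l : 'I_n -> R).
Implicit Types (z : 'I_d -> H) (x : 'I_n -> H).

(** The pair [(z, x)] as a single tuple indexed like the blocks of the matrices. *)
Definition stack z x (k : 'I_(d + n)) : H :=
  match fintype.split k with inl i => z i | inr j => x j end.

Lemma kron_id_stack k (P : 'M[R]_(k, d)) (Q : 'M[R]_(k, n)) z x i :
  kron_id (row_mx P Q) (stack z x) i = kron_id P z i + kron_id Q x i.
Proof.
rewrite /kron_id big_split_ord /=; congr (_ + _); apply: eq_bigr => j _.
  by rewrite row_mxEl /stack (unsplitK (inl j)).
by rewrite row_mxEr /stack (unsplitK (inr j)).
Qed.

(** The operator values forced by the implicit equation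
    [- M^T z + L x = x + u] of one step of the iteration. *)
Definition residual z x : 'I_n -> H := - kron_id M^T z + kron_id L x - x.

Lemma kron_id_x_row z x i : kron_id (x_row i) (stack z x) 0 = x i.
Proof.
rewrite kron_id_stack /kron_id big1 ?add0r => [|j _]; last by rewrite mxE scale0r.
rewrite (bigD1 i)//= big1 => [|j ji]; rewrite !mxE ?eqxx ?scale1r ?addr0//.
by rewrite (negPf ji) scale0r.
Qed.

Lemma kron_id_u_row z x i :
  kron_id (u_row M L i) (stack z x) 0 = residual z x i.
Proof.
transitivity (- kron_id M^T z i + (kron_id L x i - kron_id (x_row i) (stack z x) 0)).
  rewrite !kron_id_stack /kron_id [X in _ - (X + _)]big1 => [|j _]; last first.
    by rewrite mxE scale0r.
  rewrite add0r -sumrN -sumrB; congr (_ + _); apply: eq_bigr => j _.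
    by rewrite !mxE scaleNr.
  by rewrite !mxE scalerBl.
by rewrite kron_id_x_row addrA.
Qed.

Lemma gram_form_K_I z x : gram_form dot K_I (stack z x) = tuple_sqnorm z.
Proof.
rewrite K_I_factor gram_form_mul; apply: eq_bigr => i _; rewrite -hdot.
congr (`|_| ^+ 2); rewrite kron_id_stack /kron_id [X in _ + X]big1; last first.
  by move=> j _; rewrite mxE scale0r.
rewrite (bigD1 i)//= big1 => [|j ji]; rewrite !mxE ?eqxx ?scale1r ?addr0//.
by rewrite eq_sym (negPf ji) scale0r.
Qed.

Lemma gram_form_step gamma z x :
  gram_form dot ((step_mx M gamma)^T *m step_mx M gamma) (stack z x)
  = tuple_sqnorm (z + gamma *: kron_id M x).
Proof.
rewrite gram_form_mul; apply: eq_bigr => i _; rewrite -hdot.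
congr (`|_| ^+ 2); rewrite kron_id_stack; congr (_ + _).
  rewrite /kron_id (bigD1 i)//= big1 => [|j ji]; rewrite !mxE ?eqxx ?scale1r ?addr0//.
  by rewrite eq_sym (negPf ji) scale0r.
rewrite [RHS](_ : _ = gamma *: kron_id M x i)// /kron_id scaler_sumr.
by apply: eq_bigr => j _; rewrite mxE scalerA.
Qed.

Lemma gram_form_K_mu i z x :
  gram_form dot (K_mu M L mu i) (stack z x)
  = dot (x i) (residual z x i) - mu i * `|x i| ^+ 2.
Proof.
rewrite K_mu_factor gram_formD gram_formN !gram_formZ gram_formD !gram_form_mul.
rewrite !big_ord1 !kron_id_x_row !kron_id_u_row -hdot (dotC _ (residual _ _ _)).
by field.
Qed.

Lemma gram_form_K_l i z x :
  gram_form dot (K_l M L l i) (stack z x)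
  = l i ^+ 2 * `|x i| ^+ 2 - `|residual z x i| ^+ 2.
Proof.
rewrite K_l_factor gram_formD gram_formN !gram_formZ !gram_form_mul.
by rewrite !big_ord1 !kron_id_x_row !kron_id_u_row -!hdot.
Qed.

Lemma gram_form_pencil phi lambda psi gamma z x :
  gram_form dot (pencil M L mu l phi lambda psi gamma) (stack z x)
  = psi * tuple_sqnorm z
    - \sum_i phi i * (dot (x i) (residual z x i) - mu i * `|x i| ^+ 2)
    - \sum_i lambda i * (l i ^+ 2 * `|x i| ^+ 2 - `|residual z x i| ^+ 2)
    - tuple_sqnorm (z + gamma *: kron_id M x).
Proof.
rewrite !(gram_formD, gram_formN, gram_formZ) !gram_form_sum gram_form_K_I.
rewrite gram_form_step; congr (_ - _ - _ - _); apply: eq_bigr => i _.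
  by rewrite gram_formZ gram_form_K_mu.
by rewrite gram_formZ gram_form_K_l.
Qed.

End StackedForms.

(** * Contraction factors and dual feasibility *)

Section Contraction.
Context {R : realType} {H : completeNormedModType R} {d n : nat}.
Variable (dot : {dot H for idfun}).
Hypothesis (hdot : hilbert_norm dot).
Variables (M : 'M[R]_(d, n)) (L : 'M[R]_n) (mu l : 'I_n -> R) (gamma : R).
Implicit Types (z : 'I_d -> H) (x : 'I_n -> H).

Lemma kron_idB p q (P : 'M[R]_(p, q)) (x y : 'I_q -> H) :
  kron_id P (x - y) = kron_id P x - kron_id P y.
Proof.
apply/funext => i; rewrite [RHS](_ : _ = kron_id P x i - kron_id P y i)// /kron_id.
by rewrite -sumrB; apply: eq_bigr => j _; rewrite -scalerBr.
Qed.

Lemma kron_id0 p q (P : 'M[R]_(p, q)) : kron_id P (0 : 'I_q -> H) = 0.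
Proof. by apply/funext => i; apply: big1 => j _; rewrite scaler0. Qed.

Lemma tuple_sqnorm_ge0 k (z : 'I_k -> H) : 0 <= tuple_sqnorm z.
Proof. by rewrite sumr_ge0// => i _; exact: sqr_ge0. Qed.

Lemma tuple_sqnorm_gt0 k (z : 'I_k -> H) : z <> 0 -> 0 < tuple_sqnorm z.
Proof.
move=> z0; rewrite lt_def tuple_sqnorm_ge0 andbT; apply/eqP => nz; apply: z0.
apply/funext => i; apply/eqP; rewrite -normr_eq0 -sqrf_eq0; apply/eqP.
by apply: (psumr_eq0P _ nz) => // j _; exact: sqr_ge0.
Qed.

(** The quadratic constraints which [mu i]-strong monotonicity and the
    [l i]-Lipschitz condition impose on the difference of two steps. *)
Definition admissible z x : Prop := forall i,
  mu i * `|x i| ^+ 2 <= dot (x i) (residual M L z x i) /\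
  `|residual M L z x i| ^+ 2 <= l i ^+ 2 * `|x i| ^+ 2.

Lemma contraction_factor_admissible tau :
  contraction_factors dot M L mu l gamma tau ->
  exists z x, [/\ z <> 0, admissible z x &
    tau = (tuple_sqnorm (z + gamma *: kron_id M x) / tuple_sqnorm z)%:E].
Proof.
move=> [A [z10 [z20 [z11 [z21 [hA z12 [x1 [[u1 hu1 eu1] ->]] [x2 [[u2 hu2 eu2] ->]] ->]]]]]].
exists (z10 - z20), (x1 - x2); split.
- by move=> /eqP; rewrite subr_eq0 => /eqP.
- move=> i; have [_ hmono hlip] := hA i.
  have -> : residual M L (z10 - z20) (x1 - x2) i = u1 i - u2 i.
    have E1 : u1 = residual M L z10 x1 by rewrite /residual eu1 addrC addKr.
    have E2 : u2 = residual M L z20 x2 by rewrite /residual eu2 addrC addKr.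
    rewrite [RHS](_ : _ = (u1 - u2) i)// {1}E1 E2 /residual !kron_idB.
    congr (_ i); rewrite !opprD !opprK.
    rewrite [in LHS](addrACA (- _)) [LHS]addrACA.
    reflexivity.
  split; first exact: hmono (hu1 i) (hu2 i).
  have := hlip _ _ _ _ (hu1 i) (hu2 i) => h.
  rewrite -exprMn; apply: lerXn2r; rewrite ?nnegrE//.
  exact: le_trans h.
- congr ((_ / _)%:E); congr tuple_sqnorm.
  by rewrite kron_idB scalerBr opprD addrACA.
Qed.

(** The pair [(z, x)] is realized by the runs started at [z] and at [0]. *)
Lemma admissible_contraction_factor z x :
  (forall i, 0 <= mu i < l i) -> z <> 0 -> admissible z x ->
  contraction_factors dot M L mu l gamma
    (tuple_sqnorm (z + gamma *: kron_id M x) / tuple_sqnorm z)%:E.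
Proof.
move=> hmul z0 hx.
have /choice[A hA] : forall i, exists A : H -> set H,
    [/\ [/\ maximal_monotone dot A, strongly_monotone dot (mu i) A &
            lipschitz_op (l i) A], A 0 0 & A (x i) (residual M L z x i)].
  move=> i; have [h1 h2] := hx i; have /andP[mu0 mul] := hmul i.
  apply: operator_interpolation => //; first by rewrite mu0 ltW.
  have l0 : 0 <= l i by rewrite (le_trans mu0)// ltW.
  by rewrite -(ler_pXn2r (n:=2))// ?nnegrE ?mulr_ge0// exprMn.
exists A, z, 0, (z + gamma *: kron_id M x), 0; split => //.
- by move=> i; have [] := hA i.
- exists x; split => //; exists (residual M L z x); first by move=> i; have [] := hA i.
  by rewrite /residual [RHS]addrC subrK.
- exists 0; rewrite !kron_id0 scaler0 !addr0; split => //.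
  by exists 0; [move=> i; have [] := hA i | rewrite oppr0 ?addr0].
- by rewrite !subr0.
Qed.

(** Weak duality. *)
Lemma dual_bound phi lambda psi z x :
  D_feasible M L mu l phi lambda psi gamma -> admissible z x ->
  tuple_sqnorm (z + gamma *: kron_id M x) <= psi * tuple_sqnorm z.
Proof.
move=> [/psd_S_tilde psdP phi0 lambda0] hx.
have := psd_gram_form_ge0 dot _ _ (stack z x) hdot psdP.
rewrite gram_form_pencil// -addrA -!addrA -!opprD subr_ge0; apply: le_trans.
rewrite !addrA lerDr addr_ge0// sumr_ge0// => i _; rewrite mulr_ge0// subr_ge0.
- by have [] := hx i.
- by have [] := hx i.
Qed.

(** A step is determined by its starting point: forward substitution in the
    triangular system, where [L i i < 1] and monotonicity exclude a nonzero
    component. *)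
Lemma admissible0 x : is_trig_mx L -> (forall i, L i i < 1) ->
  (forall i, 0 <= mu i) -> admissible 0 x -> x = 0.
Proof.
move=> /is_trig_mxP Ltrig Ldiag mu0 hx; apply/funext => i.
have [k ik] := ubnP (nat_of_ord i); elim: k => // k IHk in i ik *.
have Eres : residual M L 0 x i = (L i i - 1) *: x i.
  rewrite [LHS](_ : _ = - kron_id M^T 0 i + kron_id L x i - x i)// kron_id0.
  rewrite [X in - X](_ : _ = 0)// oppr0 add0r scalerBl scale1r; congr (_ - _).
  rewrite /kron_id (bigD1 i)//= big1 ?addr0// => j ji.
  have [ltij|ltji|/val_inj eij] := ltngtP i j.
  - by rewrite Ltrig// scale0r.
  - by rewrite IHk ?scaler0// (leq_trans ltji).
  - by rewrite eij eqxx in ji.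
have [] := hx i; rewrite Eres dotZr -hdot => h _.
have : (mu i + (1 - L i i)) * `|x i| ^+ 2 <= 0 by lra.
rewrite pmulr_rle0; last by have := mu0 i; have := Ldiag i; lra.
by rewrite real_exprn_even_le0 ?num_real//= normr_eq0 => /eqP.
Qed.

Lemma stack_lshift_rshift (w : 'I_(d + n) -> H) :
  stack (fun i => w (lshift n i)) (fun j => w (rshift d j)) = w.
Proof.
by apply/funext => k; rewrite /stack; case: splitP => i Ei; congr w; exact: val_inj.
Qed.

(** Strong duality, up to [eps]: a bound [p] on the worst case makes the dual
    feasible at [p + eps]. *)
Lemma dual_feasible_of_worst_case_le (p eps : R) :
  is_trig_mx L -> (forall i, L i i < 1) ->
  (forall i, 0 <= mu i < l i) -> dim_ge H (d + n) ->
  (worst_case_contraction dot M L mu l gamma <= p%:E)%E -> 0 < eps ->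
  exists phi lambda, D_feasible M L mu l phi lambda (p + eps) gamma.
Proof.
move=> Ltrig Ldiag hmul hdim Wp eps0.
have [e he] := orthonormal_exists dot _ hdot hdim.
pose K (i : 'I_1 + ('I_n + 'I_n)) : 'M[R]_(d + n) :=
  match i with
  | inl _ => (step_mx M gamma)^T *m step_mx M gamma - (p + eps) *: K_I
  | inr (inl j) => K_mu M L mu j
  | inr (inr j) => K_l M L l j
  end.
have [B hB|lam [lam0 lam_gt0 lamK]] := @conic_alternative R (d + n) _ K (inl 0).
  have := stack_lshift_rshift (kron_id B^T e); set z := fun i => _; set x := fun i => _.
  move=> Ew.
  have {}hB i : 0 <= gram_form dot (K i) (stack z x).
    by rewrite Ew gram_form_orthonormal.
  have hx : admissible z x.
    move=> i; have := hB (inr (inl i)); have := hB (inr (inr i)).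
    by rewrite /= gram_form_K_mu// gram_form_K_l// !subr_ge0.
  have z0 : z = 0.
    apply: contrapT => z0; have zgt0 := tuple_sqnorm_gt0 _ _ z0.
    have := admissible_contraction_factor _ _ hmul z0 hx => /ereal_sup_ubound.
    move=> /le_trans/(_ Wp); rewrite lee_fin ler_pdivrMr// => hp.
    have := hB (inl 0); rewrite /= gram_formD gram_formN gram_formZ.
    rewrite gram_form_K_I// gram_form_step// subr_ge0 => /le_trans/(_ hp).
    by rewrite ler_pM2r//; lra.
  have x0 : x = 0.
    apply: admissible0 => //; last by rewrite -z0.
    by move=> i; have /andP[] := hmul i.
  (* Hence every column of [B] is the coordinate vector of zero. *)
  have w0 k : kron_id B^T e k = 0.
    by rewrite -Ew z0 x0 /stack; case: fintype.split.
  apply/matrixP => k i; rewrite [RHS]mxE.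
  have := dot_kron_id dot _ _ B e i i; rewrite w0 dot0l.
  rewrite (_ : \matrix_(a, b) _ = 1%:M) ?mulmx1; last first.
    by apply/matrixP => a b; rewrite !mxE he.
  rewrite mxE => /esym BB; have : B^T i k * B k i = 0.
    by apply: (psumr_eq0P _ BB) => // j _; rewrite mxE -expr2 sqr_ge0.
  by rewrite mxE => /eqP; rewrite mulf_eq0 orbb => /eqP.
(* Normalizing the weight of the objective to one makes the combination of the
   [K i] the opposite of the pencil. *)
pose c := lam (inl 0).
exists (fun i => c^-1 * lam (inr (inl i))), (fun i => c^-1 * lam (inr (inr i))).
split.
- apply/psd_S_tilde; split; first exact: pencil_sym.
  have -> : pencil M L mu l (fun i => c^-1 * lam (inr (inl i)))
      (fun i => c^-1 * lam (inr (inr i))) (p + eps) gamma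
      = - (c^-1 *: \sum_i lam i *: K i).
    rewrite big_sumType big_ord1 big_sumType /= -/c !scalerDr !scaler_sumr.
    rewrite scalerA mulVf ?gt_eqF// scale1r /pencil.
    rewrite (eq_bigr (fun i => c^-1 *: (lam (inr (inl i)) *: K_mu M L mu i))); last first.
      by move=> i _; rewrite scalerA.
    rewrite [X in _ - _ - X - _]
      (eq_bigr (fun i => c^-1 *: (lam (inr (inr i)) *: K_l M L l i))); last first.
      by move=> i _; rewrite scalerA.
    rewrite [c^-1 *: (c *: _)]scalerA mulVf ?gt_eqF// scale1r.
    by rewrite !opprD opprK [X in _ = X + _]addrC [RHS]addrAC addrA.
  move=> v; rewrite mulmxN mulNmx mxE oppr_ge0 -scalemxAr -scalemxAl mxE.
  by rewrite pmulr_rle0// invr_gt0.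
- by move=> i; rewrite mulr_ge0// invr_ge0 ltW.
- by move=> i; rewrite mulr_ge0// invr_ge0 ltW.
Qed.

End Contraction.

(** * Optimal values *)

Section OptimalValues.
Context {R : realType} {d n : nat}.
Variables (M : 'M[R]_(d, n)) (L : 'M[R]_n) (mu l : 'I_n -> R).

Lemma D_value_at_le phi lambda psi gamma :
  D_feasible M L mu l phi lambda psi gamma ->
  (D_value_at M L mu l gamma <= psi%:E)%E.
Proof. by move=> h; apply: ereal_inf_lbound; exists psi => //; exists phi, lambda. Qed.

Lemma D_value_le_at gamma : (D_value M L mu l <= D_value_at M L mu l gamma)%E.
Proof.
apply/ereal_infP => _ [psi [phi [lambda h]] <-].
by apply: ereal_inf_lbound; exists psi => //; exists phi, lambda, gamma.
Qed.

Lemma D_value_inf_range :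
  D_value M L mu l = ereal_inf (range (D_value_at M L mu l)).
Proof.
apply/eqP; rewrite eq_le; apply/andP; split; apply/ereal_infP => y.
  by move=> [gamma _ <-]; exact: D_value_le_at.
move=> [psi [phi [lambda [gamma h]]] <-]; apply: ge_ereal_inf.
by exists (D_value_at M L mu l gamma); [exists gamma | exact: D_value_at_le h].
Qed.

End OptimalValues.

Theorem theorem7 (R : realType) (H : completeNormedModType R)
    (dot : {dot H for idfun}) (hdot : hilbert_norm dot)
    (d n : nat) (M : 'M[R]_(d, n)) (L : 'M[R]_n)
    (hL : is_trig_mx L) (hLdiag : forall i, L i i < 1)
    (mu l : 'I_n -> R) (hmul : forall i, 0 <= mu i < l i) :
  (forall gamma : R,
     (worst_case_contraction dot M L mu l gamma
        <= D_value_at M L mu l gamma)%E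
     /\ (dim_ge H (d + n) ->
         D_value_at M L mu l gamma = worst_case_contraction dot M L mu l gamma))
  /\
  [/\ D_value M L mu l = ereal_inf (range (D_value_at M L mu l)),
      forall (phi lambda : 'I_n -> R) (psi gamma : R),
        D_minimizer M L mu l phi lambda psi gamma ->
        D_value_at M L mu l gamma = psi%:E
        /\ forall gamma' : R,
             (D_value_at M L mu l gamma <= D_value_at M L mu l gamma')%E
    & forall gamma : R,
        D_value_at M L mu l gamma = D_value M L mu l <->
        forall gamma' : R,
          (D_value_at M L mu l gamma <= D_value_at M L mu l gamma')%E].
Proof.
split=> [gamma|].
  have weak : (worst_case_contraction dot M L mu l gamma
                 <= D_value_at M L mu l gamma)%E.
    apply: ge_ereal_sup => tau /contraction_factor_admissible[z [x [z0 hx ->]]].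
    apply/ereal_infP => _ [psi [phi [lambda h]] <-].
    rewrite lee_fin ler_pdivrMr ?tuple_sqnorm_gt0//.
    exact: (dual_bound dot hdot) h hx.
  split=> // hdim; apply/eqP; rewrite eq_le weak andbT.
  have approx p : (worst_case_contraction dot M L mu l gamma <= p%:E)%E ->
      (D_value_at M L mu l gamma <= p%:E)%E.
    move=> Wp; apply/lee_addgt0Pr => eps eps0.
    have [phi [lambda h]] := dual_feasible_of_worst_case_le
      dot hdot _ _ _ _ _ _ _ hL hLdiag hmul hdim Wp eps0.
    exact: D_value_at_le h.
  move: (worst_case_contraction _ _ _ _ _ _) approx => [w| |] approx.
  - exact: approx.
  - exact: leey.
  - rewrite (_ : D_value_at _ _ _ _ _ = -oo%E)//; apply: eq_ninfty => p.
    by apply: approx; rewrite leNye.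
split=> [|phi lambda psi gamma [feas opt]|gamma].
- exact: D_value_inf_range.
- have E gamma' : (psi%:E <= D_value_at M L mu l gamma')%E.
    by apply/ereal_infP => _ [psi' [phi' [lambda' h]] <-]; rewrite lee_fin; exact: opt h.
  have Eg : D_value_at M L mu l gamma = psi%:E.
    by apply/eqP; rewrite eq_le E (D_value_at_le _ _ _ _ _ _ _ _ feas).
  by split=> // gamma'; rewrite Eg.
- split=> [-> gamma'|hmin]; first exact: D_value_le_at.
  apply/eqP; rewrite eq_le D_value_le_at andbT D_value_inf_range.
  by apply/ereal_infP => _ [gamma' _ <-].
Qed.
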